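(* Let $R\in\mathcal S^n$, $\sigma>0$ and $\varepsilon>0$ be given. Let $\widehat W\in\mathcal S^n$ be an approximate solution to the linear system $(\mathcal I+\sigma\mathcal Q)W\approx R$ with the residual satisfying $$\|R-(\mathcal I+\sigma\mathcal Q)\widehat W\|\le\frac{\varepsilon}{\lambda_{\max}(\mathcal Q)}.$$ Then $\widehat W_{\mathcal Q}:=\Pi_{{\rm Ran}(\mathcal Q)}(\widehat W)\in{\rm Ran}(\mathcal Q)$ solves the system $(\mathcal Q+\sigma\mathcal Q^2)W\approx\mathcal QR$, $W\in{\rm Ran}(\mathcal Q)$, with the residual satisfying $$\|\mathcal QR-(\mathcal Q+\sigma\mathcal Q^2)\widehat W_{\mathcal Q}\|\le\varepsilon.$$ Moreover, $\mathcal Q\widehat W_{\mathcal Q}=\mathcal Q\widehat W$ and $\langle\widehat W_{\mathcal Q},\mathcal Q\widehat W_{\mathcal Q}\rangle=\langle\widehat W,\mathcal Q\widehat W\rangle$.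
   Context: $\mathcal S^n$ is the space of real symmetric $n\times n$ matrices with trace inner product $\langle\cdot,\cdot\rangle$ and Frobenius norm $\|\cdot\|$. $\mathcal Q:\mathcal S^n\to\mathcal S^n$ is a self-adjoint positive semidefinite linear operator with largest eigenvalue $\lambda_{\max}(\mathcal Q)$ and range ${\rm Ran}(\mathcal Q)$; $\mathcal I$ is the identity operator; $\Pi_{{\rm Ran}(\mathcal Q)}$ is the orthogonal projection onto ${\rm Ran}(\mathcal Q)$. *)

(* Defs.v *)
From HB Require Import structures.
From mathcomp Require Import all_boot all_order all_algebra.
From mathcomp Require Import sesquilinear.
From mathcomp Require Import classical_sets reals.

Set Implicit Arguments.
Unset Strict Implicit.
Unset Printing Implicit Defensive.

Import Order.TTheory GRing.Theory Num.Theory.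

Local Open Scope ring_scope.

(* Symmetric matrices are the fixed points of transposition. As a subspace of
   'M[K]_n they form, through subvs_of, a finite-dimensional vectType, so that
   'End(symmx K n), limg, leigenvalue, etc. apply to operators on S^n. *)
Definition symv (K : fieldType) (n : nat) : {vspace 'M[K]_n} :=
  fixedSpace (linfun (@trmx K n n)).

Notation symmx K n := (subvs_of (symv K n)).

Lemma symmxP (K : fieldType) (n : nat) (A : 'M[K]_n) :
  reflect (A^T = A) (A \in symv K n).
Proof. by apply: (iffP fixedSpaceP); rewrite lfunE. Qed.

Lemma symmx_tr (K : fieldType) (n : nat) (X : symmx K n) :
  (vsval X)^T = vsval X.
Proof. exact/symmxP/subvsP. Qed.

Definition trace_inner (K : fieldType) (n : nat) (X Y : symmx K n) : K :=
  \tr (vsval X *m vsval Y).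

Section TraceInner.
Variables (K : fieldType) (n : nat).

Lemma trace_inner_is_bilinear :
  bilinear_for (GRing.Scale.Law.clone _ _ *%R _)
    (GRing.Scale.Law.clone _ _ (idfun \; *%R) _) (@trace_inner K n).
Proof.
split=> [Y|X] a U V; rewrite /trace_inner /=.
  by rewrite mulmxDl -scalemxAl linearD linearZ.
by rewrite mulmxDr -scalemxAr linearD linearZ.
Qed.

HB.instance Definition _ :=
  bilinear_isBilinear.Build K (symmx K n) (symmx K n) K _ _ (@trace_inner K n)
    trace_inner_is_bilinear.

Lemma trace_inner_is_hermitian (X Y : symmx K n) :
  trace_inner X Y = (-1) ^+ false * idfun (trace_inner Y X).
Proof. by rewrite mul1r /trace_inner /= mxtrace_mulC. Qed.

HB.instance Definition _ :=
  isHermitianSesquilinear.Build K (symmx K n) false idfun (@trace_inner K n)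
    trace_inner_is_hermitian.

End TraceInner.

Definition frobenius_norm (K : realType) (n : nat) (X : symmx K n) : K :=
  Num.sqrt (\sum_i \sum_j (vsval X i j) ^+ 2).

Definition self_adjoint (K : realType) (n : nat) (Q : 'End(symmx K n)) : Prop :=
  forall X Y, trace_inner (Q X) Y = trace_inner X (Q Y).

Definition pos_semidef (K : realType) (n : nat) (Q : 'End(symmx K n)) : Prop :=
  forall X, 0 <= trace_inner X (Q X).

(* The largest eigenvalue as a total function: the set of eigenvalues is finite,
   hence its sup is its maximum as soon as it is nonempty, which is the case for
   a self-adjoint Q and n > 0 (for n = 0, sup set0 = 0). *)
Definition lambda_max (K : realType) (n : nat) (Q : 'End(symmx K n)) : K :=
  sup [set a | passmx.leigenvalue Q a]%classic.

(* The projection onto U along the complement of U orthogonal for trace_inner. *)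
Definition orthproj (K : realType) (n : nat) (U : {vspace symmx K n}) :
    'End(symmx K n) :=
  daddv_pi U (orthov (@trace_inner K n) U).

(* Main.v *)
Require Import Defs.
From mathcomp Require Import all_boot all_order all_algebra.
From mathcomp Require Import sesquilinear ring lra.
From mathcomp Require Import classical_sets reals.

Set Implicit Arguments.
Unset Strict Implicit.
Unset Printing Implicit Defensive.

Import Order.TTheory GRing.Theory Num.Theory.

Local Open Scope ring_scope.

(** Write [<X, Y>] for the trace inner product. Since [Q] is self-adjoint, the
    orthogonal complement of its range is its kernel, so [Q WQ = Q W]; hence the
    second residual is [Q] applied to the first one, and it remains to see that
    [Q] expands norms by at most [lambda_max Q].

    Let [t] be the infimum of the [s] such that [s I - Q] is positive
    semidefinite; the infimum is attained. If [P := t I - Q] were invertible, then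
    Cauchy-Schwarz for the form of [P], applied to [P^-1 X] and [X], would give
    [<X, X> <= C <X, P X>] where [C] bounds the form of [P^-1], so that
    [(t - 1/C) I - Q] would still be positive semidefinite. Hence [t] is an
    eigenvalue of [Q], and [<X, Q X> <= lambda_max Q <X, X>]. Cauchy-Schwarz for
    the form of [Q], applied to [X] and [Q X], turns this into the norm bound. *)

Lemma discr_le0 (K : realFieldType) (a b c : K) :
  (forall t, 0 <= a + t * b *+ 2 + t ^+ 2 * c) -> b ^+ 2 <= a * c.
Proof.
move=> pos; have [c_gt0|c_lt0|c0] := ltrgtP 0 c.
(* For [c > 0] the inequality is read off at the vertex of the parabola. *)
- have := pos (- b / c).
  have -> : a + - b / c * b *+ 2 + (- b / c) ^+ 2 * c = (a * c - b ^+ 2) / c.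
    by field; rewrite gt_eqF.
  by rewrite pmulr_lge0 ?invr_gt0 // subr_ge0.
- have a_ge0 : 0 <= a by have := pos 0; rewrite expr0n /= !mul0r mul0rn !addr0.
  (* Adding the values at [s] and [- s] cancels [b] and leaves [a + s ^+ 2 * c], which this [s]
     makes negative. *)
  exfalso; pose s : K := (a + 1) / - c + 1.
  have s_gt1 : 1 <= s by rewrite lerDr divr_ge0 ?oppr_ge0 ?(ltW c_lt0) // addr_ge0.
  have sc : s * c = - (a + 1) + c by rewrite /s; field; rewrite lt_eqF.
  have := pos s; have := pos (- s).
  rewrite sqrrN expr2 -mulrA sc => h1 h2.
  have : 0 <= a + s * (- (a + 1) + c) by lra.
  nra.
have [->|b_neq0] := eqVneq b 0; first by rewrite -c0 mulr0 expr0n.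
have := pos (- (a + 1) / (b *+ 2)); rewrite -c0 mulr0 addr0.
have -> : a + - (a + 1) / (b *+ 2) * b *+ 2 = -1 by field.
by rewrite ler0N1.
Qed.

Section TraceInnerProduct.
Variables (K : realType) (n : nat).
Implicit Types (X Y : symmx K n) (A P Q : 'End(symmx K n)).

Local Notation "<[ X , Y ]>" := (trace_inner X Y) (at level 0).

Lemma trace_innerC X Y : <[X, Y]> = <[Y, X]>.
Proof. by rewrite [LHS]trace_inner_is_hermitian mul1r. Qed.

Lemma trace_innerE X Y : <[X, Y]> = \sum_i \sum_j vsval X i j * vsval Y i j.
Proof.
rewrite /trace_inner /mxtrace; apply: eq_bigr => i _; rewrite mxE.
by apply: eq_bigr => j _; rewrite -{2}(symmx_tr Y) mxE.
Qed.

Lemma frobenius_normE X : frobenius_norm X = Num.sqrt <[X, X]>.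
Proof.
by rewrite trace_innerE; congr Num.sqrt; do 2!apply: eq_bigr => ? _; rewrite expr2.
Qed.

Lemma sqr_entry_le X i j : (vsval X i j) ^+ 2 <= <[X, X]>.
Proof.
rewrite trace_innerE pair_bigA (bigD1 (i, j)) //= -expr2 lerDl.
by apply: sumr_ge0 => p _; rewrite -expr2 sqr_ge0.
Qed.

Lemma trace_inner_ge0 X : 0 <= <[X, X]>.
Proof.
rewrite trace_innerE; apply: sumr_ge0 => i _; apply: sumr_ge0 => j _.
by rewrite -expr2 sqr_ge0.
Qed.

Lemma trace_inner_eq0 X : (<[X, X]> == 0) = (X == 0).
Proof.
apply/idP/idP => [/eqP X0|/eqP->]; last by rewrite linear0l.
apply/eqP/val_inj/matrixP => i j; rewrite linear0 mxE; apply/eqP.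
by rewrite -sqrf_eq0 eq_le sqr_ge0 andbT -X0 sqr_entry_le.
Qed.

Lemma trace_inner_gt0 X : (0 < <[X, X]>) = (X != 0).
Proof. by rewrite lt_def trace_inner_ge0 andbT trace_inner_eq0. Qed.

Lemma psd_cauchy_schwarz P : self_adjoint P -> pos_semidef P ->
  forall X Y, <[X, P Y]> ^+ 2 <= <[X, P X]> * <[Y, P Y]>.
Proof.
move=> Psa Ppsd X Y; apply: discr_le0 => t; have := Ppsd (X + t *: Y).
rewrite linearD linearZ /= !(linearDl, linearDr) /= !(linearZl_LR, linearZr_LR) /=.
rewrite -(Psa Y X) (trace_innerC (P Y) X).
by congr (0 <= _); ring.
Qed.

(** Off the diagonal [delta_mx] is not symmetric, so the usual expansion is pushed through the
    linear projection [vsproj], which fixes [X]; the coefficients remain entries of [X], hence are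
    controlled by [sqr_entry_le]. *)
Lemma symmx_sum_delta X :
  X = \sum_(p : 'I_n * 'I_n)
        vsval X p.1 p.2 *: vsproj (symv K n) (delta_mx p.1 p.2).
Proof.
rewrite -{1}(vsvalK X) {1}(matrix_sum_delta (vsval X)) pair_bigA linear_sum /=.
by apply: eq_bigr => p _; rewrite linearZ.
Qed.

Lemma quadratic_form_bounded A :
  exists2 C : K, 0 < C & forall X, <[X, A X]> <= C * <[X, X]>.
Proof.
pose s (p : 'I_n * 'I_n) := vsproj (symv K n) (delta_mx p.1 p.2).
pose C := \sum_p \sum_q `|<[s p, A (s q)]>|.
have C_ge0 : 0 <= C by apply: sumr_ge0 => p _; apply: sumr_ge0.
(* [C] may vanish; the added 1 makes the constant positive, hence invertible. *)
exists (1 + C) => [|X]; first by rewrite ltr_pwDl.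
apply: (@le_trans _ _ (C * <[X, X]>)); last first.
  by rewrite ler_wpM2r ?trace_inner_ge0 // lerDr.
rewrite {1 2}(symmx_sum_delta X) linear_sum /= linear_sumlz mulr_suml.
apply: ler_sum => p _; rewrite linear_sumr mulr_suml.
apply: ler_sum => q _; rewrite linearZ /= linearZl_LR linearZr_LR /=.
rewrite mulrA mulrC -/(s p) -/(s q).
set x := vsval X _ _; set y := vsval X _ _; set N := <[X, X]>.
have xN : x ^+ 2 <= N by exact: sqr_entry_le.
have yN : y ^+ 2 <= N by exact: sqr_entry_le.
rewrite (le_trans (ler_norm _)) // normrM ler_wpM2l // ler_norml.
have := sqr_ge0 (x + y); have := sqr_ge0 (x - y).
by move=> h1 h2; apply/andP; split; nra.
Qed.

Lemma max_eigenvalue Q : self_adjoint Q -> forall X0, X0 != 0 ->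
  exists2 t, passmx.leigenvalue Q t & forall X, <[X, Q X]> <= t * <[X, X]>.
Proof.
move=> Qsa X0 X0_neq0.
pose S : set K := [set s | forall X, <[X, Q X]> <= s * <[X, X]>]%classic.
have S_lb X : X != 0 -> lbound S (<[X, Q X]> / <[X, X]>).
  by rewrite -trace_inner_gt0 => X_gt0 s /(_ X); rewrite ler_pdivrMr.
have S_n0 : (S !=set0)%classic.
  by have [C _ CP] := quadratic_form_bounded Q; exists C.
(* The infimum is attained because every Rayleigh quotient is a lower bound of [S], hence at most
   [inf S]. *)
have S_inf : S (inf S).
  move=> X; have [->|X_neq0] := eqVneq X 0; first by rewrite !linear0l mulr0.
  by rewrite -ler_pdivrMr ?trace_inner_gt0 // lb_le_inf //; exact: S_lb.
exists (inf S) => //; apply/negP => /eqP ker0.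
set t := inf S in S_inf ker0 *; pose P := (t *: \1 - Q)%VF.
have PE X : P X = t *: X - Q X by rewrite !lfunE /= opp_lfunE scale_lfunE id_lfunE.
have Psa : self_adjoint P.
  by move=> X Y; rewrite !PE linearBl linearBr /= linearZl_LR linearZr_LR /= Qsa.
have PX X : <[X, P X]> = t * <[X, X]> - <[X, Q X]>.
  by rewrite PE linearBr /= linearZr_LR.
have Ppsd : pos_semidef P by move=> X; rewrite PX subr_ge0.
(* The eigenspace in [ker0] is the kernel of [Q - t I], the opposite of [P]. *)
have kerP : lker P == 0%VS.
  apply/eqP/vspaceP => X; rewrite -ker0 !memv_ker -oppr_eq0.
  by rewrite PE add_lfunE opp_lfunE scale_lfunE id_lfunE opprB.
have [C C_gt0 CP] := quadratic_form_bounded (P^-1)%VF.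
suff : S (t - C^-1).
  move=> tS; have : t <= t - C^-1 :> K.
    by apply: ge_inf => //; eexists; exact: (S_lb _ X0_neq0).
  by have : 0 < C^-1; [rewrite invr_gt0 | lra].
move=> X; have [->|] := eqVneq X 0; first by rewrite !linear0l mulr0.
rewrite -trace_inner_gt0 => X_gt0.
have := psd_cauchy_schwarz Psa Ppsd (P^-1%VF X) X.
rewrite -Psa lker0_lfunVK // (trace_innerC _ X) => CS.
have : <[X, X]> ^+ 2 <= C * <[X, X]> * <[X, P X]>.
  by rewrite (le_trans CS) // ler_wpM2r.
rewrite expr2 -mulrA mulrCA ler_pM2l // PX -ler_pdivrMl //.
by rewrite mulrBl => h; lra.
Qed.

Lemma rayleigh_le_lambda_max Q : self_adjoint Q ->
  forall X, <[X, Q X]> <= lambda_max Q * <[X, X]>.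
Proof.
move=> Qsa X; have [->|X_neq0] := eqVneq X 0; first by rewrite !linear0l mulr0.
have [t t_eig tP] := max_eigenvalue Qsa X_neq0.
rewrite (le_trans (tP X)) // ler_wpM2r ?trace_inner_ge0 //.
(* The supremum is meaningful only for a bounded set: testing [tP] on an eigenvector for [a] gives
   [a <= t]. *)
apply: ub_le_sup => //; exists t => a /= a_eig.
have v_neq0 : vpick (passmx.leigenspace Q a) != 0 by rewrite vpick0.
have := memv_pick (passmx.leigenspace Q a); set v := vpick _ in v_neq0 *.
rewrite memv_ker add_lfunE opp_lfunE scale_lfunE id_lfunE subr_eq0 => /eqP Qv.
by have := tP v; rewrite Qv linearZr_LR /= ler_pM2r // trace_inner_gt0.
Qed.

Lemma frobenius_norm_psd_le Q : self_adjoint Q -> pos_semidef Q ->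
  forall X, frobenius_norm (Q X) <= lambda_max Q * frobenius_norm X.
Proof.
move=> Qsa Qpsd X; rewrite !frobenius_normE.
have [->|] := eqVneq X 0; first by rewrite linear0 !linear0l sqrtr0 mulr0.
rewrite -trace_inner_gt0 => X_gt0.
have ray := rayleigh_le_lambda_max Qsa.
have l_ge0 : 0 <= lambda_max Q.
  by rewrite -(pmulr_lge0 _ X_gt0) (le_trans (Qpsd X)).
rewrite -[X in X * _](ger0_norm l_ge0) -sqrtr_sqr -sqrtrM ?sqr_ge0 //.
apply: ler_wsqrtr; have := trace_inner_ge0 (Q X).
rewrite le_eqVlt => /predU1P[<-|QX_gt0].
  by rewrite mulr_ge0 ?sqr_ge0 // ltW.
(* After multiplication by [<[Q X, Q X]>], the left side is the square of [<[X, Q (Q X)]>], to which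
   Cauchy-Schwarz applies. *)
rewrite -(ler_pM2l QX_gt0) -expr2 {1}Qsa.
rewrite (le_trans (psd_cauchy_schwarz Qsa Qpsd X (Q X))) //.
rewrite (le_trans (ler_pM (Qpsd _) (Qpsd _) (ray X) (ray (Q X)))) //.
by rewrite le_eqVlt; apply/orP; left; apply/eqP; ring.
Qed.

(** If [X] is orthogonal to the range, pairing it with [Q (Q X)] gives [<[Q X, Q X]> = 0]. *)
Lemma orthov_limg Q : self_adjoint Q ->
  orthov (@trace_inner K n) (limg Q) = lker Q.
Proof.
move=> Qsa; apply/vspaceP => X; apply/mem_orthovP/idP => [XQ|].
  by rewrite memv_ker -trace_inner_eq0 Qsa XQ // memv_img ?memvf.
rewrite memv_ker => /eqP QX0 _ /memv_imgP[Y _ ->].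
by rewrite -[LHS]/(<[X, Q Y]>) -Qsa QX0 linear0l.
Qed.

Lemma orthproj_limg_ker Q : self_adjoint Q ->
  forall X, Q (orthproj (limg Q) X) = Q X.
Proof.
move=> Qsa X; rewrite /orthproj orthov_limg //.
(* Splitting [X] with [daddv_pi] requires range and kernel to be complementary: definiteness gives
   the trivial intersection, rank-nullity the full sum. *)
have cap0 : (limg Q :&: lker Q)%VS = 0%VS.
  apply/eqP; rewrite -subv0 -(orthov_limg Qsa); apply/subvP => Y.
  rewrite memv_cap memv0 -trace_inner_eq0 => /andP[YQ /mem_orthovP YY].
  by rewrite YY.
have full : (limg Q + lker Q)%VS = fullv.
  apply/eqP; rewrite -(dimv_leqif_eq (subvf _)) dimv_disjoint_sum //.
  by rewrite addnC -(limg_ker_dim Q fullv) capfv.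
rewrite -{2}(@daddv_pi_add _ _ (limg Q) (lker Q) X) ?full ?memvf // linearD /=.
have : daddv_pi (lker Q) (limg Q) X \in lker Q by exact: memv_pi.
by rewrite memv_ker => /eqP ->; rewrite addr0.
Qed.

End TraceInnerProduct.

Theorem proposition4p1 (K : realType) (n : nat) (Q : 'End(symmx K n))
    (Qsa : self_adjoint Q) (Qpsd : pos_semidef Q)
    (R : symmx K n) (sigma eps : K) (sigma_gt0 : 0 < sigma) (eps_gt0 : 0 < eps)
    (W : symmx K n)
    (W_approx :
      frobenius_norm (R - (\1 + sigma *: Q)%VF W) <= eps / lambda_max Q) :
  let WQ := orthproj (limg Q) W in
  [/\ WQ \in limg Q,
      frobenius_norm (Q R - (Q + sigma *: (Q \o Q))%VF WQ) <= eps,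
      Q WQ = Q W
    & trace_inner WQ (Q WQ) = trace_inner W (Q W)].
Proof.
move=> WQ; have QWQ : Q WQ = Q W by exact: orthproj_limg_ker.
split=> //; first exact: memv_pi.
  have -> : Q R - (Q + sigma *: (Q \o Q))%VF WQ
            = Q (R - (\1 + sigma *: Q)%VF W).
    rewrite !add_lfunE !scale_lfunE comp_lfunE id_lfunE QWQ.
    by rewrite [RHS]linearB [X in _ = _ - X]linearD [X in _ = _ - (_ + X)]linearZ.
  rewrite (le_trans (frobenius_norm_psd_le Qsa Qpsd _)) //.
  (* If [lambda_max Q <= 0], as for [Q = 0], the quotient in [W_approx] carries no useful bound, but
     the product to be bounded is already nonpositive. *)
  have [l_gt0|l_le0] := ltP 0 (lambda_max Q).
    by rewrite mulrC -ler_pdivlMr.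
  by rewrite (le_trans _ (ltW eps_gt0)) // mulr_le0_ge0 // sqrtr_ge0.
by rewrite QWQ -Qsa QWQ Qsa.
Qed.
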